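(* Let $w_1,w_2,w_3$ be positive integers, $n\ge0$ an integer, and $y_1\in\mathbb{Z}_p$. Then \begin{align*} &w_1^{n-1}\sum_{k=0}^n\binom{n}{k}S_{n-k,q^{w_1w_2}}(w_3-1)\,w_2^{n-k}w_3^{k-1}\sum_{i=0}^{w_1-1}q^{w_2w_3i}B_{k,q^{w_1w_3}}\Big(w_2y_1+\frac{w_2}{w_1}i\Big)\\ &=w_1^{n-1}\sum_{k=0}^n\binom{n}{k}S_{n-k,q^{w_1w_3}}(w_2-1)\,w_3^{n-k}w_2^{k-1}\sum_{i=0}^{w_1-1}q^{w_2w_3i}B_{k,q^{w_1w_2}}\Big(w_3y_1+\frac{w_3}{w_1}i\Big)\\ &=w_2^{n-1}\sum_{k=0}^n\binom{n}{k}S_{n-k,q^{w_1w_2}}(w_3-1)\,w_1^{n-k}w_3^{k-1}\sum_{i=0}^{w_2-1}q^{w_1w_3i}B_{k,q^{w_2w_3}}\Big(w_1y_1+\frac{w_1}{w_2}i\Big)\\ &=w_2^{n-1}\sum_{k=0}^n\binom{n}{k}S_{n-k,q^{w_2w_3}}(w_1-1)\,w_3^{n-k}w_1^{k-1}\sum_{i=0}^{w_2-1}q^{w_1w_3i}B_{k,q^{w_1w_2}}\Big(w_3y_1+\frac{w_3}{w_2}i\Big)\\ &=w_3^{n-1}\sum_{k=0}^n\binom{n}{k}S_{n-k,q^{w_1w_3}}(w_2-1)\,w_1^{n-k}w_2^{k-1}\sum_{i=0}^{w_3-1}q^{w_1w_2i}B_{k,q^{w_2w_3}}\Big(w_1y_1+\frac{w_1}{w_3}i\Big)\\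 &=w_3^{n-1}\sum_{k=0}^n\binom{n}{k}S_{n-k,q^{w_2w_3}}(w_1-1)\,w_2^{n-k}w_1^{k-1}\sum_{i=0}^{w_3-1}q^{w_1w_2i}B_{k,q^{w_1w_3}}\Big(w_2y_1+\frac{w_2}{w_3}i\Big). \end{align*}
   Context: Let $p$ be a prime, $\mathbb{C}_p$ the completion of an algebraic closure of $\mathbb{Q}_p$, and $|\cdot|_p$ the absolute value on $\mathbb{C}_p$ with $|p|_p=1/p$. Fix $q\in\mathbb{C}_p$ with $q\neq 1$ and $|q-1|_p<p^{-1/(p-1)}$; for every positive integer $w$, $Q=q^w$ also satisfies these conditions. For such $Q$, the $Q$-Bernoulli numbers are defined by $\frac{\log Q+t}{Qe^t-1}=\sum_{n\ge0}B_{n,Q}\frac{t^n}{n!}$ ($\log$ the $p$-adic logarithm), and the $Q$-Bernoulli polynomials by $\frac{\log Q+t}{Qe^t-1}e^{xt}=\sum_{n\ge0}B_{n,Q}(x)\frac{t^n}{n!}$, i.e. $B_{n,Q}(x)=\sum_{j=0}^n\binom{n}{j}B_{j,Q}x^{n-j}$ (a polynomial, evaluated at elements of $\mathbb{C}_p$). For integers $k\ge0$, $N\ge0$, $S_{k,Q}(N)=\sum_{i=0}^N i^kQ^i$, with $0^0=1$. *)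

(* Defs.v *)
From HB Require Import structures.
From mathcomp Require Import all_boot all_order all_algebra.
From mathcomp Require Import all_classical all_reals all_analysis.

Set Implicit Arguments.
Unset Strict Implicit.
Unset Printing Implicit Defensive.

Import Order.TTheory GRing.Theory Num.Theory.
Import numFieldNormedType.Exports.

Local Open Scope classical_set_scope.
Local Open Scope ring_scope.

Section ValuedFields.
Variable R : realType.

Record nonarch_absval (K : fieldType) (v : K -> R) : Prop := NonarchAbsval {
  absval_ge0 : forall x, 0 <= v x;
  absval_eq0 : forall x, v x = 0 <-> x = 0;
  absvalM : forall x y, v (x * y) = v x * v y;
  absvalD : forall x y, v (x + y) <= Num.max (v x) (v y) }.

Definition vcvg (K : fieldType) (v : K -> R) (u : nat -> K) (l : K) : Prop :=
  (fun n => v (u n - l)) @ \oo --> (0 : R).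

Definition vcauchy (K : fieldType) (v : K -> R) (u : nat -> K) : Prop :=
  forall e : R, 0 < e -> exists N : nat, forall m n : nat,
    (N <= m)%N -> (N <= n)%N -> v (u m - u n) < e.

(* The limit of u, or 0 when u diverges. *)
Definition vlim (K : fieldType) (v : K -> R) (u : nat -> K) : K :=
  xget 0 [set l | vcvg v u l].

Definition vcomplete (K : fieldType) (v : K -> R) : Prop :=
  forall u : nat -> K, vcauchy v u -> exists l : K, vcvg v u l.

Record is_completion (F K : fieldType) (vF : F -> R) (vK : K -> R)
    (i : {rmorphism F -> K}) : Prop := IsCompletion {
  completion_absval : nonarch_absval vK;
  completion_isometry : forall x, vK (i x) = vF x;
  completion_dense : forall (y : K) (e : R), 0 < e ->
    exists x : F, vK (y - i x) < e;
  completion_complete : vcomplete vK }.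

Record is_algebraic_closure (F L : fieldType) (i : {rmorphism F -> L}) : Prop :=
  IsAlgebraicClosure {
  algebraic_closure_closed : GRing.closed_field_axiom L;
  algebraic_closure_algebraic : forall x : L, algebraicOver i x }.

Definition padic_norm (p : nat) (x : rat) : R :=
  if x == 0 then 0
  else p%:R ^ ((logn p `|denq x|)%:Z - (logn p `|numq x|)%:Z).

(* C_p with the tower Q -> Q_p -> Qbar_p -> C_p it is built from; these data
   are unique up to isometric isomorphism.  The R-valued absolute values are
   normalized by |p| = 1/p through padic_norm. *)
Record padic_complex (p : nat) : Type := PadicComplex {
  Qp : fieldType;
  Qp_abs : Qp -> R;
  Qp_of_rat : {rmorphism rat -> Qp};
  Qp_completion : is_completion (padic_norm p) Qp_abs Qp_of_rat;
  Qpbar : fieldType;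
  Qpbar_abs : Qpbar -> R;
  Qpbar_of_Qp : {rmorphism Qp -> Qpbar};
  Qpbar_closure : is_algebraic_closure Qpbar_of_Qp;
  Qpbar_absval : nonarch_absval Qpbar_abs;
  Qpbar_extends : forall x : Qp, Qpbar_abs (Qpbar_of_Qp x) = Qp_abs x;
  Cp :> fieldType;
  Cp_abs : Cp -> R;
  Cp_of_Qpbar : {rmorphism Qpbar -> Cp};
  Cp_completion : is_completion Qpbar_abs Cp_abs Cp_of_Qpbar } as C.

Definition Cp_of_Qp (p : nat) (C : padic_complex p) (x : Qp C) : C :=
  Cp_of_Qpbar C (Qpbar_of_Qp C x).

Definition padic_int (p : nat) (C : padic_complex p) : set (Qp C) :=
  [set x | Qp_abs x <= 1].

(* log x = \sum_(n >= 1) (-1)^(n-1) (x - 1)^n / n, used where |x - 1| < 1. *)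
Definition padic_log (p : nat) (C : padic_complex p) (x : C) : C :=
  vlim (@Cp_abs p C)
    (fun N => \sum_(1 <= n < N) (-1) ^+ n.-1 * (x - 1) ^+ n / n%:R).

End ValuedFields.

(* Formal power series in t, given by their coefficients. *)
Section FormalPowerSeries.
Variable K : fieldType.
Implicit Types a b : nat -> K.

Definition fps_mul a b : nat -> K := fun n => \sum_(i < n.+1) a i * b (n - i)%N.

Fixpoint fps_inv_seq a (n : nat) : seq K :=
  if n is m.+1 then
    let s := fps_inv_seq a m in
    rcons s ((a 0%N)^-1 * ((m == 0%N)%:R - \sum_(i < m) s`_i * a (m - i)%N))
  else [::].

(* The multiplicative inverse of a when a 0 != 0, see fps_mulVf. *)
Definition fps_inv a : nat -> K := fun n => (fps_inv_seq a n.+1)`_n.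

Lemma size_fps_inv_seq a n : size (fps_inv_seq a n) = n.
Proof. by elim: n => //= n IH; rewrite size_rcons IH. Qed.

Lemma nth_fps_inv_seq a n i : (i < n)%N -> (fps_inv_seq a n)`_i = fps_inv a i.
Proof.
elim: n => // n IH; rewrite ltnS leq_eqVlt => /predU1P[->//|lt_in].
by rewrite /= nth_rcons size_fps_inv_seq lt_in IH.
Qed.

Lemma fps_mulVf a : a 0%N != 0 -> fps_mul (fps_inv a) a = fun n => (n == 0%N)%:R.
Proof.
move=> a0; apply/funext => n; rewrite /fps_mul big_ord_recr /= subnn.
have -> : fps_inv a n =
    (a 0%N)^-1 * ((n == 0%N)%:R - \sum_(i < n) fps_inv a i * a (n - i)%N).
  rewrite /fps_inv /= nth_rcons size_fps_inv_seq ltnn eqxx.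
  by under eq_bigr do rewrite nth_fps_inv_seq //.
by rewrite mulrAC mulVf // mul1r addrC subrK.
Qed.

(* e^(c t) *)
Definition fps_exp (c : K) : nat -> K := fun n => c ^+ n / n`!%:R.

End FormalPowerSeries.

Section QBernoulli.
Variables (R : realType) (p : nat) (C : padic_complex R p).

(* (log Q + t) / (Q e^t - 1) *)
Definition qbernoulli_gf (Q : C) : nat -> C :=
  fps_mul (fun n => if n is m.+1 then (m == 0%N)%:R else padic_log Q)
          (fps_inv (fun n => Q * fps_exp 1 n - (n == 0%N)%:R)).

Definition qbernoulli_num (n : nat) (Q : C) : C := n`!%:R * qbernoulli_gf Q n.

Definition qbernoulli_poly (n : nat) (Q : C) : {poly C} :=
  \sum_(j < n.+1) ('C(n, j)%:R * qbernoulli_num j Q) *: 'X^(n - j).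

Definition qpower_sum (k : nat) (Q : C) (N : nat) : C :=
  \sum_(i < N.+1) i%:R ^+ k * Q ^+ i.

Lemma Cp_natr_neq0 (n : nat) : (0 < n)%N -> n%:R != 0 :> C.
Proof.
move=> n0.
rewrite -(rmorph_nat (Cp_of_Qpbar C)) fmorph_eq0.
rewrite -(rmorph_nat (Qpbar_of_Qp C)) fmorph_eq0.
rewrite -(rmorph_nat (Qp_of_rat C)) fmorph_eq0.
by rewrite pnatr_eq0 -lt0n.
Qed.

(* The exponential generating series of B_{n,Q}(x) is
   (log Q + t) / (Q e^t - 1) * e^(x t). *)
Lemma qbernoulli_polyE (n : nat) (Q x : C) :
  (qbernoulli_poly n Q).[x] =
  n`!%:R * fps_mul (qbernoulli_gf Q) (fps_exp x) n.
Proof.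
rewrite /qbernoulli_poly /fps_mul horner_sum mulr_sumr.
apply: eq_bigr => -[j /=]; rewrite ltnS => le_jn _.
rewrite hornerZ hornerXn /qbernoulli_num /fps_exp -(bin_fact le_jn) !natrM.
have nf0 : (n - j)`!%:R != 0 :> C by rewrite Cp_natr_neq0 ?fact_gt0.
rewrite -!mulrA; congr (_ * (_ * _)); rewrite mulrCA; congr (_ * _).
by rewrite mulrCA divff // mulr1.
Qed.

End QBernoulli.

(* Main.v *)
From HB Require Import structures.
Require Import Defs.
From mathcomp Require Import all_boot all_order all_algebra.
From mathcomp Require Import all_classical all_reals all_analysis.
From mathcomp Require Import ring.

Set Implicit Arguments.
Unset Strict Implicit.
Unset Printing Implicit Defensive.

Import Order.TTheory GRing.Theory Num.Theory.
Import numFieldNormedType.Exports.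

Local Open Scope classical_set_scope.
Local Open Scope ring_scope.

(** Write [U_m = q^m e^(m t) - 1] and [W = w1 w2 w3].  Summing the geometric
    series hidden in the power sums and in the sums over [i], each of the six
    expressions is [n!] times the coefficient of [t^n] in
    [(log q + t) e^(W y t) U_W^2 / (U_(w1 w2) U_(w1 w3) U_(w2 w3))],
    which is symmetric in [w1, w2, w3].  The arithmetic input is that
    [log (q^m) = m log q] and that [q^m <> 1], so that the [U_m] are
    invertible.  The former follows from [log x = lim (x^(p^N) - 1) / p^N],
    and it implies the latter because [|log q| = |q - 1|] on the disc:
    there the linear term [x - 1] of the logarithmic series dominates. *)

Lemma exprn_sub1E (A : comNzRingType) (x : A) n :
  x ^+ n - 1 = \sum_(1 <= k < n.+1) 'C(n, k)%:R * (x - 1) ^+ k.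
Proof.
rewrite -{1}(subrK 1 x) [_ - 1 + 1]addrC exprDn.
rewrite -(big_mkord xpredT
  (fun k => (1 ^+ (n - k) * (x - 1) ^+ k) *+ 'C(n, k))).
rewrite big_ltn// bin0 expr0 expr1n mulr1 addrC addKr.
by apply: eq_bigr => k _; rewrite expr1n mul1r mulr_natl.
Qed.

Lemma predn_mul_logn_le p n : (p.-1 * logn p n <= n.-1)%N.
Proof.
have [->|n_gt0] := posnP n; first by rewrite logn0 muln0.
have [p_gt1|p_le1] := ltnP 1 p; last by case: p p_le1 => [|[|]].
apply: (@leq_trans (p ^ logn p n).-1).
  rewrite predn_exp leq_mul2l -[leqLHS]card_ord -sum1_card.
  by rewrite leq_sum ?orbT// => i _; rewrite expn_gt0 ltnW.
by rewrite -ltnS !prednK ?expn_gt0 ?(ltnW p_gt1)// dvdn_leq// pfactor_dvdnn.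
Qed.

Section RealSequences.
Context {R : realType}.
Implicit Types (r : R) (k n p : nat).

Lemma natr_mul_exprn_le r n : 0 <= r < 1 -> n%:R * r ^+ n <= (1 - r)^-1.
Proof.
move=> /andP[r_ge0 r_lt1]; have r'_gt0 : 0 < 1 - r by rewrite subr_gt0.
rewrite -[leRHS]div1r ler_pdivlMr//.
have : n%:R * r ^+ n <= \sum_(i < n) r ^+ i.
  rewrite -[n in n%:R]card_ord -sum1_card natr_sum mulr_suml.
  by apply: ler_sum => i _; rewrite mul1r ler_wiXn2l ?(ltW r_lt1)// ltnW.
move=> /(ler_wpM2r (ltW r'_gt0))/le_trans; apply.
by rewrite mulrC -opprB mulNr -subrX1 opprB gerBl exprn_ge0.
Qed.

Lemma cvg_natrX_mul_exprn k r : 0 <= r < 1 ->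
  (fun n => n%:R ^+ k * r ^+ n) @ \oo --> 0.
Proof.
elim: k r => [|k IH] r /andP[r_ge0 r_lt1].
  under eq_fun do rewrite expr0 mul1r.
  by apply: cvg_expr; rewrite ger0_norm.
pose s := Num.sqrt r; have s01 : 0 <= s < 1.
  by rewrite sqrtr_ge0 -sqrtr1 ltr_sqrt.
have -> : (fun n => n%:R ^+ k.+1 * r ^+ n) =
    (fun n => (n%:R * s ^+ n) * (n%:R ^+ k * s ^+ n)).
  apply/funext => n; rewrite -(sqr_sqrtr r_ge0) -/s exprS -exprM mulnC exprM.
  by rewrite expr2; ring.
have s_ge0 : 0 <= s by rewrite sqrtr_ge0.
apply: (@squeeze_cvgr _ _ _ _ (fun=> 0)
    (fun n => (1 - s)^-1 * (n%:R ^+ k * s ^+ n))) => //.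
- apply: nearW => n; have ks_ge0 : 0 <= n%:R ^+ k * s ^+ n.
    by rewrite mulr_ge0 ?exprn_ge0.
  by rewrite !mulr_ge0 ?exprn_ge0//= ler_wpM2r// natr_mul_exprn_le.
- exact: cvg_cst.
- rewrite -[X in _ --> X](mulr0 (1 - s)^-1).
  exact: cvgM (cvg_cst _) (IH _ s01).
Qed.

Lemma natrX_mul_exprn_bounded k r : 0 <= r < 1 ->
  exists B, forall n, n%:R ^+ k * r ^+ n <= B.
Proof.
move=> /(cvg_natrX_mul_exprn k)/cvgP/cvg_seq_bounded.
by move=> /bounded_fun_has_ubound[B B_ub]; exists B => n; apply: B_ub; exists n.
Qed.

Lemma cvg_natr_exprV p : (1 < p)%N -> (fun n => p%:R ^- n : R) @ \oo --> 0.
Proof.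
move=> p_gt1; under eq_fun do rewrite -exprVn.
apply: cvg_expr; rewrite ger0_norm ?invr_ge0//.
by rewrite invf_lt1 ?ltr1n// ltr0n ltnW.
Qed.

Definition padic_exp_radius p : R := p%:R `^ (- (p%:R - 1)^-1).

Lemma exprn_pred_lt_inv p r : (1 < p)%N -> 0 <= r -> r < padic_exp_radius p ->
  r ^+ p.-1 < p%:R^-1.
Proof.
move=> p_gt1 r_ge0 r_lt.
have p1E : p.-1%:R = p%:R - 1 :> R by rewrite -subn1 natrB// ltnW.
have p1_gt0 : (0 < p.-1)%N by rewrite -ltnS prednK// ltnW.
have -> : p%:R^-1 = padic_exp_radius p ^+ p.-1.
  rewrite /padic_exp_radius -powR_mulrn ?powR_ge0// -powRrM -p1E mulNr.
  rewrite mulVf ?powR_inv1//.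
  by rewrite pnatr_eq0 -lt0n.
by rewrite ltrXn2r ?nnegrE ?powR_ge0// -lt0n.
Qed.

End RealSequences.

(** * Nonarchimedean absolute values *)

Section NonarchAbsval.
Context {R : realType} {K : fieldType} {v : K -> R} (hv : nonarch_absval v).
Implicit Types (x y l : K) (B : R) (a u : nat -> K).

Let v_ge0 x : 0 <= v x. Proof. exact: absval_ge0 hv x. Qed.

Lemma absval0 : v 0 = 0. Proof. exact/(absval_eq0 hv). Qed.

Lemma absval_gt0 x : x != 0 -> 0 < v x.
Proof.
move=> x_neq0; rewrite lt0r v_ge0 andbT.
by apply: contra_neq x_neq0 => /(absval_eq0 hv).
Qed.

Lemma absval1 : v 1 = 1.
Proof.
have v1_neq0 : v 1 != 0 by rewrite gt_eqF// absval_gt0// oner_neq0.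
by apply: (mulfI v1_neq0); rewrite -(absvalM hv) !mulr1.
Qed.

Lemma absvalN x : v (- x) = v x.
Proof.
suff vN1 : v (-1) = 1 by rewrite -mulN1r (absvalM hv) vN1 mul1r.
apply/eqP; rewrite -(@eqrXn2 _ 2)// expr1n expr2.
by rewrite -(absvalM hv) mulN1r opprK absval1.
Qed.

Lemma absval_distrC x y : v (x - y) = v (y - x).
Proof. by rewrite -absvalN opprB. Qed.

Lemma absvalX x n : v (x ^+ n) = v x ^+ n.
Proof.
by elim: n => [|n IH]; rewrite ?expr0 ?absval1// !exprS (absvalM hv) IH.
Qed.

Lemma absvalV x : v x^-1 = (v x)^-1.
Proof.
have [->|x_neq0] := eqVneq x 0; first by rewrite invr0 absval0 invr0.
by apply: divr1_eq; rewrite invrK -(absvalM hv) mulVf// absval1.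
Qed.

Lemma absvalD_le x y B : v x <= B -> v y <= B -> v (x + y) <= B.
Proof.
by move=> xB yB; apply: le_trans (absvalD hv _ _) _; rewrite ge_max xB.
Qed.

Lemma absvalD_lt x y B : v x < B -> v y < B -> v (x + y) < B.
Proof.
by move=> xB yB; apply: le_lt_trans (absvalD hv _ _) _; rewrite gt_max xB.
Qed.

Lemma absvalD_le_add x y : v (x + y) <= v x + v y.
Proof. by apply: absvalD_le; rewrite ?lerDl ?lerDr v_ge0. Qed.

Lemma absvalD_dominant x y : v y < v x -> v (x + y) = v x.
Proof.
move=> yx; apply/le_anti; rewrite absvalD_le ?(ltW yx)//= leNgt.
apply/negP => xyx.
have := absvalD_lt xyx (_ : v (- y) < v x).
by rewrite absvalN addrK ltxx => /(_ yx).
Qed.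

Lemma absval_sum_le (I : eqType) (r : seq I) (P : pred I) (F : I -> K) B :
  0 <= B -> (forall i, i \in r -> P i -> v (F i) <= B) ->
  v (\sum_(i <- r | P i) F i) <= B.
Proof.
move=> B_ge0 FB; rewrite big_seq_cond.
apply: (big_ind (fun x => v x <= B)) => [|x y|i /andP[]]; last exact: FB.
  by rewrite absval0.
exact: absvalD_le.
Qed.

Lemma absval_sum_lt (I : eqType) (r : seq I) (P : pred I) (F : I -> K) B :
  0 < B -> (forall i, i \in r -> P i -> v (F i) < B) ->
  v (\sum_(i <- r | P i) F i) < B.
Proof.
move=> B_gt0 FB; rewrite big_seq_cond.
apply: (big_ind (fun x => v x < B)) => [|x y|i /andP[]]; last exact: FB.
  by rewrite absval0.
exact: absvalD_lt.
Qed.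

Lemma absval_natr_le1 n : v n%:R <= 1.
Proof.
elim: n => [|n IH]; first by rewrite absval0.
by rewrite -natr1 absvalD_le// absval1.
Qed.

Lemma absvalX_sub1_le x n : v (x - 1) <= 1 -> v (x ^+ n - 1) <= v (x - 1).
Proof.
move=> x1; rewrite subrX1 (absvalM hv) ler_piMr//.
apply: absval_sum_le => // i _ _; rewrite absvalX exprn_ile1//.
by rewrite -(subrK 1 x) absvalD_le// absval1.
Qed.

Lemma absval_geometric_sum_sub_le x n : v (x - 1) <= 1 ->
  v (\sum_(i < n) x ^+ i - n%:R) <= v (x - 1).
Proof.
move=> x1; rewrite -[n in n%:R]card_ord -sum1_card natr_sum -sumrB.
by apply: absval_sum_le => // i _ _; apply: absvalX_sub1_le.
Qed.

Lemma vcvg_squeeze u l (e : nat -> R) :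
  (forall n, v (u n - l) <= e n) -> e @ \oo --> 0 -> vcvg v u l.
Proof.
move=> ue e0; apply: (squeeze_cvgr _ (@cvg_cst _ 0 _ _ _) e0).
by apply: nearW => n; rewrite v_ge0 ue.
Qed.

Lemma vcvg_near_lt u l B : vcvg v u l -> 0 < B ->
  exists N, forall n, (N <= n)%N -> v (u n - l) < B.
Proof.
move=> ul B_gt0; have [N _ uN] := (cvgr0Pnorm_lt _).1 ul _ B_gt0.
by exists N => n /uN /=; rewrite ger0_norm// v_ge0.
Qed.

Lemma vcvg_unique u l l' : vcvg v u l -> vcvg v u l' -> l = l'.
Proof.
move=> ul ul'; have l_near : vcvg v (fun=> l) l'.
  apply: (@vcvg_squeeze _ _ (fun n => v (u n - l) + v (u n - l'))) => [n|].
    by rewrite -(subrKA (u n)) [v (u n - l)]absval_distrC absvalD_le_add.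
  by rewrite -[X in _ --> X]addr0; apply: cvgD ul ul'.
apply/eqP; rewrite -subr_eq0; apply/eqP/(absval_eq0 hv).
exact: (cvg_unique _ (@cvg_cst _ _ _ _ _) l_near).
Qed.

Lemma vcvgM u u' l l' :
  vcvg v u l -> vcvg v u' l' -> vcvg v (fun n => u n * u' n) (l * l').
Proof.
move=> ul ul'; apply: (@vcvg_squeeze _ _ (fun n =>
    v (u n - l) * v (u' n - l') + (v l * v (u' n - l') + v l' * v (u n - l)))).
  move=> n; rewrite -!(absvalM hv).
  have -> : u n * u' n - l * l' =
      (u n - l) * (u' n - l') + (l * (u' n - l') + l' * (u n - l)) by ring.
  by rewrite (le_trans (absvalD_le_add _ _))// lerD2l absvalD_le_add.
have -> : 0 = 0 * 0 + (v l * 0 + v l' * 0) :> R by rewrite !mulr0 !addr0.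
by apply: cvgD; [exact: cvgM|apply: cvgD; apply: cvgM => //; exact: cvg_cst].
Qed.

Lemma vcvg_of_cvg_dist0 u u' l : vcvg v u l ->
  (fun n => v (u' n - u n)) @ \oo --> 0 -> vcvg v u' l.
Proof.
move=> ul uu'.
apply: (@vcvg_squeeze _ _ (fun n => v (u' n - u n) + v (u n - l))).
  by move=> n; rewrite -(subrKA (u n)) absvalD_le_add.
by rewrite -[X in _ --> X]addr0; apply: cvgD uu' ul.
Qed.

Lemma vcvg_vlim u l : vcvg v u l -> vcvg v u (vlim v u).
Proof. by move=> ul; rewrite /vlim; case: xgetP => [? -> //|/(_ l)]. Qed.

Lemma vcvg_series_vlim a m : vcomplete v -> (v \o a) @ \oo --> 0 ->
  let s n := \sum_(m <= k < n) a k in vcvg v s (vlim v s).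
Proof.
move=> Kc a0 s; suff [l sl] : exists l, vcvg v s l by exact: vcvg_vlim sl.
apply: Kc => e e_gt0.
have [N _ aN] := (cvgr0Pnorm_lt _).1 a0 _ e_gt0.
have s_tail i j : (maxn m N <= i <= j)%N -> v (s j - s i) < e.
  rewrite geq_max => /andP[/andP[mi Ni] ij].
  rewrite /s (big_cat_nat mi ij)/= addrAC subrr add0r.
  apply: absval_sum_lt => // k.
  rewrite mem_index_iota => /andP[ik _] _.
  by have /= := aN k (leq_trans Ni ik); rewrite ger0_norm// v_ge0.
exists (maxn m N) => i j Ni Nj; have [ij|/ltnW ji] := leqP i j.
  by rewrite absval_distrC s_tail// Ni.
by rewrite s_tail// Nj.
Qed.

End NonarchAbsval.

(** * The p-adic logarithm *)

Section PadicLogarithm.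
Context {R : realType} {p : nat} (p_prime : prime p) (C : padic_complex R p).
Implicit Types x : C.

Local Notation v := (@Cp_abs R p C).

Let hv : nonarch_absval v.
Proof. exact: completion_absval (Cp_completion C). Qed.

Let v_ge0 x : 0 <= v x. Proof. exact: absval_ge0 hv x. Qed.

Let p_exprV_ge0 n : 0 <= p%:R ^- n :> R.
Proof. by rewrite invr_ge0 exprn_ge0. Qed.

Lemma Cp_abs_natr n : (0 < n)%N -> v n%:R = p%:R ^- logn p n.
Proof.
move=> n_gt0; rewrite -(rmorph_nat (Cp_of_Qpbar C)).
rewrite (completion_isometry (Cp_completion C)).
rewrite -(rmorph_nat (Qpbar_of_Qp C)) Qpbar_extends.
rewrite -(rmorph_nat (Qp_of_rat C)) (completion_isometry (Qp_completion C)).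
rewrite /padic_norm pnatr_eq0 gtn_eqF//.
have -> : n%:R = (Posz n)%:~R :> rat by [].
by rewrite numq_int denq_int /= logn1 sub0r -exprnN.
Qed.

Lemma Cp_abs_prime_exp n : v (p ^ n)%:R = p%:R ^- n.
Proof. by rewrite Cp_abs_natr ?expn_gt0 ?prime_gt0// pfactorK. Qed.

Lemma Cp_abs_natrV_le n : v n%:R^-1 <= n%:R.
Proof.
have [->|n_gt0] := posnP n; first by rewrite invr0 (absval0 hv).
rewrite (absvalV hv) Cp_abs_natr// invrK -natrX ler_nat.
by rewrite dvdn_leq// pfactor_dvdnn.
Qed.

(* The binomial coefficients C(p^N, m+1) = p^N / (m+1) * C(p^N - 1, m) are
   p-adically small, so C(p^N - 1, m) nearly changes sign at each step of m. *)
Lemma Cp_abs_bin_pred_prime_exp_le N m :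
  v ('C((p ^ N).-1, m)%:R - (-1) ^+ m) <= m%:R * p%:R ^- N.
Proof.
set P := (p ^ N)%N; have P_gt0 : (0 < P)%N by rewrite expn_gt0 prime_gt0.
elim: m => [|m IH]; first by rewrite bin0 subrr (absval0 hv) mul0r.
have binP : 'C(P.-1, m.+1)%:R + 'C(P.-1, m)%:R =
    P%:R * (m.+1%:R^-1 * 'C(P.-1, m)%:R) :> C.
  have m_neq0 : m.+1%:R != 0 :> C by rewrite Cp_natr_neq0.
  apply: (mulfI m_neq0); rewrite mulrCA mulVKf//.
  by rewrite -natrD -!natrM -binS prednK// mul_bin_diag.
have -> : 'C(P.-1, m.+1)%:R - (-1) ^+ m.+1 =
    P%:R * (m.+1%:R^-1 * 'C(P.-1, m)%:R) - ('C(P.-1, m)%:R - (-1) ^+ m) :> C.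
  by rewrite -binP exprS; ring.
apply: (absvalD_le hv); last first.
  by rewrite (absvalN hv) (le_trans IH)// ler_wpM2r// ler_nat.
rewrite !(absvalM hv) Cp_abs_prime_exp mulrC ler_wpM2r//.
rewrite -[leRHS]mulr1 ler_pM ?Cp_abs_natrV_le//.
exact: absval_natr_le1.
Qed.

Definition padic_log_term x n : C := (-1) ^+ n.-1 * (x - 1) ^+ n / n%:R.

Lemma vcvg_padic_log x : v (x - 1) < 1 ->
  vcvg v (fun N => \sum_(1 <= n < N) padic_log_term x n) (padic_log x).
Proof.
move=> x1; apply: (vcvg_series_vlim hv).
  exact: completion_complete (Cp_completion C).
have x01 : 0 <= v (x - 1) < 1 by rewrite v_ge0.
apply: (squeeze_cvgr _ (@cvg_cst _ 0 _ _ _) (cvg_natrX_mul_exprn 1 x01)).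
apply: nearW => n /=; rewrite v_ge0/= !(absvalM hv) !(absvalX hv).
rewrite (absvalN hv) (absval1 hv) expr1n mul1r mulrC expr1.
by rewrite ler_wpM2r ?exprn_ge0// Cp_abs_natrV_le.
Qed.

Definition log_quotient x N : C := (x ^+ (p ^ N) - 1) / (p ^ N)%:R.

Lemma log_quotientE x N : log_quotient x N =
  \sum_(1 <= n < (p ^ N).+1) 'C((p ^ N).-1, n.-1)%:R * (x - 1) ^+ n / n%:R.
Proof.
rewrite /log_quotient exprn_sub1E mulr_suml; set P := (p ^ N)%N.
have P_neq0 : P%:R != 0 :> C by rewrite Cp_natr_neq0// expn_gt0 prime_gt0.
apply: eq_big_nat => -[|n]// _ /=.
have n_neq0 : n.+1%:R != 0 :> C by rewrite Cp_natr_neq0.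
have <- : n.+1%:R * 'C(P, n.+1)%:R / P%:R = 'C(P.-1, n)%:R :> C.
  by apply: (canLR (mulfK P_neq0)); rewrite [RHS]mulrC -!natrM mul_bin_diag.
by move: n.+1%:R P%:R n_neq0 P_neq0 => a b a0 b0; field; rewrite a0.
Qed.

Lemma log_quotient_dist_le x N B :
  (forall n, n%:R ^+ 2 * v (x - 1) ^+ n <= B) ->
  v (log_quotient x N - \sum_(1 <= n < (p ^ N).+1) padic_log_term x n)
    <= B * p%:R ^- N.
Proof.
move=> B_ge; rewrite log_quotientE -sumrB.
apply: (absval_sum_le hv) => [|n _ _].
  by rewrite mulr_ge0// (le_trans _ (B_ge 0%N))// expr0n mul0r.
rewrite /padic_log_term -!mulrBl !(absvalM hv) (absvalX hv).
apply: (@le_trans _ _ (n%:R * p%:R ^- N * v (x - 1) ^+ n * n%:R)).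
  have vx_ge0 : 0 <= v (x - 1) ^+ n by rewrite exprn_ge0.
  rewrite ler_pM ?mulr_ge0 ?Cp_abs_natrV_le// ler_wpM2r//.
  rewrite (le_trans (Cp_abs_bin_pred_prime_exp_le _ _))// ler_wpM2r//.
  by rewrite ler_nat leq_pred.
rewrite [leLHS](_ : _ = n%:R ^+ 2 * v (x - 1) ^+ n * p%:R ^- N); last by ring.
by rewrite ler_wpM2r.
Qed.

Lemma vcvg_log_quotient x : v (x - 1) < 1 ->
  vcvg v (log_quotient x) (padic_log x).
Proof.
move=> x1; have x01 : 0 <= v (x - 1) < 1 by rewrite v_ge0.
pose partial_sum N := \sum_(1 <= n < (p ^ N).+1) padic_log_term x n.
have partial_sum_cvg : vcvg v partial_sum (padic_log x).
  apply: (cvg_comp (fun N => (p ^ N).+1) _ _ (vcvg_padic_log x1)).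
  apply/cvgnyPge => A; exists A => // N /= AN.
  by rewrite (leq_trans AN)// ltnW// ltnS ltnW// ltn_expl// prime_gt1.
have [B B_ge] := natrX_mul_exprn_bounded 2 x01.
have B_cvg : (fun N => B * p%:R ^- N) @ \oo --> 0.
  rewrite -[X in _ --> X](mulr0 B).
  exact: cvgM (cvg_cst _) (cvg_natr_exprV (prime_gt1 p_prime)).
apply: (vcvg_of_cvg_dist0 hv partial_sum_cvg).
apply: (squeeze_cvgr _ (@cvg_cst _ 0 _ _ _) B_cvg); apply: nearW => N.
by rewrite v_ge0 log_quotient_dist_le.
Qed.

Lemma log_quotientX x w N : log_quotient (x ^+ w) N =
  log_quotient x N * \sum_(i < w) (x ^+ (p ^ N)) ^+ i.
Proof. by rewrite /log_quotient -exprM mulnC exprM subrX1 mulrAC. Qed.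

Lemma vcvg_expr_prime_exp x : v (x - 1) < 1 ->
  vcvg v (fun N => x ^+ (p ^ N)) 1.
Proof.
move=> x1; rewrite /vcvg.
have -> : (fun N => v (x ^+ (p ^ N) - 1)) =
    (fun N => v (log_quotient x N * (p ^ N)%:R - padic_log x * 0)).
  apply/funext => N; rewrite mulr0 subr0 /log_quotient divfK//.
  by rewrite Cp_natr_neq0// expn_gt0 prime_gt0.
apply: (vcvgM hv (vcvg_log_quotient x1)).
apply: (vcvg_squeeze hv _ (cvg_natr_exprV (prime_gt1 p_prime))) => N.
by rewrite subr0 Cp_abs_prime_exp.
Qed.

Lemma padic_logX x w : v (x - 1) < 1 -> padic_log (x ^+ w) = padic_log x *+ w.
Proof.
move=> x1; have xw1 : v (x ^+ w - 1) < 1.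
  by rewrite (le_lt_trans _ x1)// (absvalX_sub1_le hv)// ltW.
apply: (vcvg_unique hv (vcvg_log_quotient xw1)).
rewrite -mulr_natr; have -> : log_quotient (x ^+ w) =
    (fun N => log_quotient x N * \sum_(i < w) (x ^+ (p ^ N)) ^+ i).
  by apply/funext => N; rewrite log_quotientX.
apply: (vcvgM hv (vcvg_log_quotient x1)).
apply: (vcvg_squeeze hv _ (vcvg_expr_prime_exp x1)) => N.
apply: (absval_geometric_sum_sub_le hv).
by rewrite (le_trans (absvalX_sub1_le hv _ _))// ltW.
Qed.

Lemma Cp_abs_sub1_lt1 x : v (x - 1) < padic_exp_radius p -> v (x - 1) < 1.
Proof.
have p_gt1 := prime_gt1 p_prime.
move=> /(exprn_pred_lt_inv p_gt1 (v_ge0 _)) xp.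
have p1_gt0 : (0 < p.-1)%N by rewrite -ltnS prednK// ltnW.
rewrite -(expr_lt1 p1_gt0 (v_ge0 _)) (lt_trans xp)//.
by rewrite invf_lt1 ?ltr1n// ltr0n ltnW.
Qed.

Lemma Cp_abs_padic_log_term_lt x n : x != 1 ->
  v (x - 1) < padic_exp_radius p -> (1 < n)%N ->
  v (padic_log_term x n) < v (x - 1).
Proof.
case: n => // n x_neq1 x_disc n_gt0; have x1 := Cp_abs_sub1_lt1 x_disc.
have vx_gt0 : 0 < v (x - 1) by rewrite (absval_gt0 hv)// subr_eq0.
have xp := exprn_pred_lt_inv (prime_gt1 p_prime) (ltW vx_gt0) x_disc.
have vn_gt0 : 0 < v n.+1%:R by rewrite (absval_gt0 hv)// Cp_natr_neq0.
rewrite !(absvalM hv) !(absvalX hv) (absvalV hv) (absvalN hv) (absval1 hv).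
rewrite expr1n mul1r exprS -mulrA gtr_pMr// ltr_pdivrMr// mul1r Cp_abs_natr//.
have := predn_mul_logn_le p n.+1; case: (logn p n.+1) => [|k] pk_le.
  by rewrite expr0 invr1 exprn_ilt1 ?(ltW vx_gt0)// -lt0n.
rewrite (le_lt_trans (ler_wiXn2l (ltW vx_gt0) (ltW x1) pk_le))// exprM -exprVn.
by rewrite ltrXn2r ?nnegrE ?exprn_ge0 ?invr_ge0// (ltW vx_gt0).
Qed.

Lemma padic_log1 : padic_log (1 : C) = 0.
Proof. by rewrite -(expr0 1) padic_logX ?mulr0n// subrr (absval0 hv). Qed.

Lemma Cp_abs_padic_log x : v (x - 1) < padic_exp_radius p ->
  v (padic_log x) = v (x - 1).
Proof.
move=> x_disc.
have [->|x_neq1] := eqVneq x 1; first by rewrite padic_log1 subrr.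
have vx_gt0 : 0 < v (x - 1) by rewrite (absval_gt0 hv)// subr_eq0.
have log_cvg := vcvg_padic_log (Cp_abs_sub1_lt1 x_disc).
have [N log_near] := vcvg_near_lt hv log_cvg vx_gt0.
pose tail := \sum_(2 <= n < N.+2) padic_log_term x n.
have tail_lt : v tail < v (x - 1).
  apply: (absval_sum_lt hv) => // n; rewrite mem_index_iota => /andP[n_gt1 _] _.
  exact: Cp_abs_padic_log_term_lt.
have {log_near} := log_near N.+2 (leqW (leqnSn N)).
rewrite big_ltn// -/tail {1}/padic_log_term mul1r expr1 divr1.
rewrite (absval_distrC hv) => log_near.
rewrite -(subrK (x - 1 + tail) (padic_log x)) addrCA.
by apply: (absvalD_dominant hv); apply: (absvalD_lt hv).
Qed.

Lemma Cp_expr_eq1 x m : v (x - 1) < padic_exp_radius p -> (0 < m)%N ->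
  (x ^+ m == 1) = (x == 1).
Proof.
move=> x_disc m_gt0; apply/eqP/eqP => [xm1|->]; last exact: expr1n.
have : padic_log x *+ m = 0.
  by rewrite -padic_logX ?Cp_abs_sub1_lt1// xm1 padic_log1.
rewrite -mulr_natl => /eqP; rewrite mulf_eq0 (negPf (Cp_natr_neq0 C m_gt0)) /=.
move=> /eqP/(absval_eq0 hv); rewrite Cp_abs_padic_log// => /(absval_eq0 hv)/eqP.
by rewrite subr_eq0 => /eqP.
Qed.

End PadicLogarithm.

(** * The ring of formal power series *)

(* The canonical product of [nat -> K] is pointwise; the alias carries the
   Cauchy product. *)
Definition fps (K : fieldType) : Type := nat -> K.

Section FpsRing.
Context {K : fieldType}.
Implicit Types a b c : nat -> K.

Definition fps_one : nat -> K := fun n => (n == 0%N)%:R.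

Lemma fps_mul_coef_poly a b N n : (n < N)%N ->
  fps_mul a b n = ((\poly_(i < N) a i) * (\poly_(i < N) b i))`_n.
Proof.
move=> nN; rewrite coefM; apply: eq_bigr => i _.
rewrite !coef_poly (leq_ltn_trans (leq_subr _ _) nN).
by rewrite (leq_ltn_trans _ nN)// -ltnS.
Qed.

Lemma fps_mulC : commutative (@fps_mul K).
Proof.
move=> a b; apply/funext => n.
by rewrite !(fps_mul_coef_poly _ _ (ltnSn n)) mulrC.
Qed.

Lemma fps_mulA : associative (@fps_mul K).
Proof.
have mulE a b c n : fps_mul (fps_mul a b) c n =
    (\poly_(i < n.+1) a i * \poly_(i < n.+1) b i * \poly_(i < n.+1) c i)`_n.
  rewrite coefM; apply: eq_bigr => i _.
  by rewrite (fps_mul_coef_poly _ _ (ltn_ord i)) coef_poly ltnS leq_subr.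
by move=> a b c; apply/funext => n; rewrite fps_mulC !mulE [in LHS]mulrC mulrA.
Qed.

Lemma fps_mul1 : left_id fps_one (@fps_mul K).
Proof.
move=> a; apply/funext => n; rewrite /fps_mul big_ord_recl /= mul1r subn0.
by rewrite big1 ?addr0// => i _; rewrite mul0r.
Qed.

Lemma fps_mulDl : left_distributive (@fps_mul K) +%R.
Proof.
move=> a b c; apply/funext => n; rewrite /fps_mul.
by under eq_bigr do rewrite mulrDl; rewrite big_split.
Qed.

Lemma fps_one_neq0 : fps_one != 0.
Proof. by apply/eqP => /(congr1 (@^~ 0%N)) /eqP; rewrite /fps_one oner_eq0. Qed.

End FpsRing.

HB.instance Definition _ (K : fieldType) :=
  GRing.Zmodule.copy (fps K) (nat -> K).
HB.instance Definition _ (K : fieldType) :=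
  GRing.Zmodule_isComNzRing.Build (fps K)
    fps_mulA fps_mulC fps_mul1 fps_mulDl fps_one_neq0.

Section FpsUnitRing.
Context {K : fieldType}.
Implicit Types a b : fps K.

Lemma fps_coefM a b n : (a * b) n = \sum_(i < n.+1) a i * b (n - i)%N.
Proof. by []. Qed.

Lemma fps_coefB a b n : (a - b) n = a n - b n. Proof. by []. Qed.

Lemma fps_coef_sum I (r : seq I) (P : pred I) (F : I -> fps K) n :
  (\sum_(i <- r | P i) F i) n = \sum_(i <- r | P i) F i n.
Proof. exact: (big_morph (fun a : fps K => a n)). Qed.

Definition fps_unit : pred (fps K) := [pred a | a 0%N != 0].

Definition fps_invr a : fps K := if a 0%N != 0 then fps_inv a else a.

Lemma fps_mulVr : {in fps_unit, left_inverse 1 fps_invr *%R}.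
Proof.
move=> a a_unit; have a0 : a 0%N != 0 by [].
by rewrite /fps_invr a0; apply: fps_mulVf.
Qed.

Lemma fps_unitPl a b : b * a = 1 -> fps_unit a.
Proof.
move=> /(congr1 (@^~ 0%N)); rewrite fps_coefM big_ord1 => ba1.
by apply/eqP => a0; move/eqP: ba1; rewrite a0 mulr0 eq_sym oner_eq0.
Qed.

Lemma fps_invr_out : {in [predC fps_unit], fps_invr =1 id}.
Proof. by move=> a; rewrite !inE /fps_invr => /negPf ->. Qed.

End FpsUnitRing.

HB.instance Definition _ (K : fieldType) :=
  GRing.ComNzRing_hasMulInverse.Build (fps K)
    fps_mulVr fps_unitPl fps_invr_out.

Section FpsTheory.
Context {K : fieldType}.
Implicit Types (a b : fps K) (x y z : K).

Lemma fps_unitE a : (a \is a GRing.unit) = (a 0%N != 0).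
Proof. by []. Qed.

Lemma fps_invE a : a 0%N != 0 -> fps_inv a = a^-1.
Proof. by move=> a0; rewrite /GRing.inv /= /fps_invr /= a0. Qed.

Definition fpsC z : fps K := fun n => if n is 0%N then z else 0.

Lemma fps_coefCM z a n : (fpsC z * a) n = z * a n.
Proof.
rewrite fps_coefM big_ord_recl /= subn0.
by rewrite big1 ?addr0// => i _; rewrite mul0r.
Qed.

Lemma fpsC_is_zmod_morphism : zmod_morphism fpsC.
Proof. by move=> x y; apply/funext => -[|n]; rewrite fps_coefB//= subr0. Qed.

Lemma fpsC_is_monoid_morphism : monoid_morphism fpsC.
Proof.
split=> [|x y]; first by apply/funext => -[].
by apply/funext => n; rewrite fps_coefCM; case: n => //= n; rewrite mulr0.
Qed.

HB.instance Definition _ :=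
  GRing.isZmodMorphism.Build K (fps K) fpsC fpsC_is_zmod_morphism.
HB.instance Definition _ :=
  GRing.isMonoidMorphism.Build K (fps K) fpsC fpsC_is_monoid_morphism.

(* a(z t) *)
Definition fps_dilate z a : fps K := fun n => z ^+ n * a n.

Lemma fps_dilate_is_zmod_morphism z : zmod_morphism (fps_dilate z).
Proof.
by move=> a b; apply/funext => n; rewrite /fps_dilate !fps_coefB mulrBr.
Qed.

Lemma fps_dilateC z x : fps_dilate z (fpsC x) = fpsC x.
Proof.
by apply/funext => -[|n]; rewrite /fps_dilate ?expr0 ?mul1r//= mulr0.
Qed.

Lemma fps_dilate_is_monoid_morphism z : monoid_morphism (fps_dilate z).
Proof.
split=> [|a b]; first by rewrite -(rmorph1 fpsC) fps_dilateC.
apply/funext => n; rewrite /fps_dilate !fps_coefM mulr_sumr.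
apply: eq_bigr => i _; rewrite mulrACA -exprD subnKC//.
by rewrite -ltnS.
Qed.

HB.instance Definition _ z := GRing.isZmodMorphism.Build (fps K) (fps K)
  (fps_dilate z) (fps_dilate_is_zmod_morphism z).
HB.instance Definition _ z := GRing.isMonoidMorphism.Build (fps K) (fps K)
  (fps_dilate z) (fps_dilate_is_monoid_morphism z).

Lemma fps_dilate_exp z x : fps_dilate z (fps_exp x) = fps_exp (z * x).
Proof. by apply/funext => n; rewrite /fps_dilate /fps_exp exprMn mulrA. Qed.

Lemma fps_exp_coef0 x : fps_exp x 0%N = 1.
Proof. by rewrite /fps_exp expr0 fact0 divr1. Qed.

Lemma fps_exp0 : fps_exp (0 : K) = (1 : fps K).
Proof.
by apply/funext => -[|n]; rewrite ?fps_exp_coef0// /fps_exp expr0n mul0r.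
Qed.

Hypothesis K_char0 : forall n, (0 < n)%N -> n%:R != 0 :> K.

Let fact_neq0 n : n`!%:R != 0 :> K. Proof. by rewrite K_char0 ?fact_gt0. Qed.

Lemma fact_fps_coefM a b n : n`!%:R * (a * b) n =
  \sum_(k < n.+1) 'C(n, k)%:R * (k`!%:R * a k) * ((n - k)`!%:R * b (n - k)%N).
Proof.
rewrite fps_coefM mulr_sumr; apply: eq_bigr => -[k /=]; rewrite ltnS => kn _.
by rewrite -(bin_fact kn) !natrM; ring.
Qed.

Lemma fact_fps_exp x n : n`!%:R * fps_exp x n = x ^+ n.
Proof. by rewrite /fps_exp mulrC divfK. Qed.

Lemma fps_expD x y : fps_exp (x + y) = (fps_exp x : fps K) * fps_exp y.
Proof.
apply/funext => n; apply: (mulfI (fact_neq0 n)); rewrite fact_fps_coefM.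
rewrite fact_fps_exp addrC exprDn; apply: eq_bigr => k _.
by rewrite !fact_fps_exp -mulrA mulr_natl mulrC.
Qed.

Lemma fps_expMn x n : fps_exp (x *+ n) = (fps_exp x : fps K) ^+ n.
Proof.
elim: n => [|n IH]; first by rewrite mulr0n fps_exp0.
by rewrite mulrS fps_expD IH exprS.
Qed.

End FpsTheory.

(** * Generating series *)

Section QExponential.
Context {K : fieldType}.
Implicit Types q : K.

Definition qexp q m : fps K := fpsC (q ^+ m) * fps_exp m%:R.

Lemma qexp_sub1_unit q m : (qexp q m - 1 \is a GRing.unit) = (q ^+ m != 1).
Proof.
by rewrite fps_unitE fps_coefB /qexp fps_coefCM fps_exp_coef0 mulr1 subr_eq0.
Qed.

Lemma fps_dilate_qexp q m : fps_dilate m%:R (qexp (q ^+ m) 1) = qexp q m.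
Proof. by rewrite rmorphM/= fps_dilateC fps_dilate_exp mulr1. Qed.

Hypothesis K_char0 : forall n, (0 < n)%N -> n%:R != 0 :> K.

Lemma qexpM q m n : qexp q (m * n) = qexp q m ^+ n.
Proof. by rewrite /qexp exprMn -fps_expMn// -rmorphXn -exprM mulrnA. Qed.

Lemma qexp_geometric_sum q m n : q ^+ m != 1 ->
  \sum_(i < n) qexp q m ^+ i = (qexp q (m * n) - 1) / (qexp q m - 1).
Proof.
by move=> qm_neq1; rewrite qexpM subrX1 mulrC mulKr// qexp_sub1_unit.
Qed.

End QExponential.

Section QBernoulliSymmetry.
Context {R : realType} {p : nat} {C : padic_complex R p}.
Implicit Types (q Q y : C) (a b c k m n w : nat).

Let Cp_char0 n : (0 < n)%N -> n%:R != 0 :> C := @Cp_natr_neq0 R p C n.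

Definition log_add_t Q : fps C :=
  fun n => if n is m.+1 then (m == 0%N)%:R else padic_log Q.

Lemma qbernoulli_gfE Q : Q != 1 ->
  qbernoulli_gf Q = (log_add_t Q / (qexp Q 1 - 1) : fps C).
Proof.
move=> Q_neq1; rewrite -fps_invE; last first.
  by rewrite -fps_unitE qexp_sub1_unit expr1.
congr (fps_mul _ (fps_inv _)); apply/funext => n.
by rewrite fps_coefB /qexp fps_coefCM.
Qed.

Lemma fact_coef_qexp_sum q w c m : (0 < c)%N ->
  m`!%:R * (\sum_(j < c) qexp q w ^+ j) m =
  w%:R ^+ m * qpower_sum m (q ^+ w) (c - 1).
Proof.
move=> c_gt0; rewrite /qpower_sum subn1 prednK// fps_coef_sum !mulr_sumr.
apply: eq_bigr => j _; rewrite -qexpM// /qexp fps_coefCM mulrCA fact_fps_exp//.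
by rewrite natrM exprMn exprM; ring.
Qed.

Definition qbernoulli_translates_gf q y a b c : fps C :=
  (\sum_(i < a) qexp q (b * c) ^+ i) *
    (fps_dilate (a * c)%:R (qbernoulli_gf (q ^+ (a * c)))
     * fps_exp ((a * b * c)%:R * y)).

Lemma fact_coef_qbernoulli_translates_gf q y a b c k : (0 < a)%N ->
  k`!%:R * qbernoulli_translates_gf q y a b c k =
  (a * c)%:R ^+ k * \sum_(i < a) q ^+ (b * c * i)
    * (qbernoulli_poly k (q ^+ (a * c))).[b%:R * y + b%:R / a%:R * i%:R].
Proof.
move=> a_gt0; have a_neq0 := Cp_char0 a_gt0.
rewrite /qbernoulli_translates_gf mulr_suml fps_coef_sum !mulr_sumr.
apply: eq_bigr => i _; rewrite qbernoulli_polyE -qexpM// /qexp.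
set z : C := b%:R * y + _; set g : fps C := qbernoulli_gf _.
have -> : fpsC (q ^+ (b * c * i)) * fps_exp (b * c * i)%:R *
    (fps_dilate (a * c)%:R g * fps_exp ((a * b * c)%:R * y)) =
  fpsC (q ^+ (b * c * i)) * fps_dilate (a * c)%:R (g * fps_exp z).
  rewrite [in RHS](rmorphM _ g)/= fps_dilate_exp -mulrA; congr (_ * _).
  rewrite mulrCA -fps_expD//; congr (_ * _); congr fps_exp.
  by rewrite /z !natrM; field.
by rewrite fps_coefCM /fps_dilate -[fps_mul _ _]/(g * fps_exp z); ring.
Qed.

Definition symmetric_series q y a b c : fps C :=
  log_add_t q * fps_exp ((a * b * c)%:R * y) * (qexp q (a * b * c) - 1) ^+ 2
  / (qexp q (a * b) - 1) / (qexp q (a * c) - 1) / (qexp q (b * c) - 1).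

Lemma symmetric_series_swapl q y a b c :
  symmetric_series q y a b c = symmetric_series q y b a c.
Proof. by rewrite /symmetric_series [(b * a)%N]mulnC mulrAC. Qed.

Lemma symmetric_series_swapr q y a b c :
  symmetric_series q y a b c = symmetric_series q y a c b.
Proof.
rewrite /symmetric_series [(c * b)%N]mulnC [(a * c * b)%N]mulnAC.
by congr (_ / _); exact: mulrAC.
Qed.

Definition qbernoulli_sum q y n a b c : C := a%:R ^ (n%:Z - 1) *
  \sum_(k < n.+1) 'C(n, k)%:R
    * qpower_sum (n - k) (q ^+ (a * b)) (c - 1)
    * b%:R ^+ (n - k) * c%:R ^ (k%:Z - 1)
    * \sum_(i < a) q ^+ (b * c * i)
        * (qbernoulli_poly k (q ^+ (a * c))).[b%:R * y + b%:R / a%:R * i%:R].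

Lemma qbernoulli_sum_coef q y n a b c : (0 < a)%N -> (0 < c)%N ->
  qbernoulli_sum q y n a b c = n`!%:R *
    (fpsC (a * c)%:R^-1 * qbernoulli_translates_gf q y a b c
     * \sum_(j < c) qexp q (a * b) ^+ j) n.
Proof.
move=> a_gt0 c_gt0.
have a_neq0 := Cp_char0 a_gt0; have c_neq0 := Cp_char0 c_gt0.
rewrite fact_fps_coefM// /qbernoulli_sum mulr_sumr; apply: eq_bigr => k _.
rewrite fps_coefCM fact_coef_qexp_sum// [k`!%:R * _]mulrCA.
rewrite fact_coef_qbernoulli_translates_gf//.
have kn : (k <= n)%N by rewrite -ltnS.
rewrite !expfzDr// !exprN1 -!exprnP -[in a%:R ^+ n](subnKC kn) exprD.
by rewrite !natrM !exprMn; field; rewrite c_neq0.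
Qed.

Hypothesis p_prime : prime p.
Variable q : C.
Hypothesis q_neq1 : q != 1.
Hypothesis q_disc : Cp_abs (q - 1) < padic_exp_radius p.

Let qX_neq1 m : (0 < m)%N -> q ^+ m != 1.
Proof. by move=> m_gt0; rewrite Cp_expr_eq1. Qed.

Lemma fps_dilate_qbernoulli_gf m : (0 < m)%N ->
  fps_dilate m%:R (qbernoulli_gf (q ^+ m)) =
  fpsC m%:R * log_add_t q / (qexp q m - 1).
Proof.
move=> m_gt0; rewrite qbernoulli_gfE ?qX_neq1//.
rewrite rmorphM rmorphV/=; last by rewrite qexp_sub1_unit expr1 qX_neq1.
rewrite rmorphB rmorph1/= fps_dilate_qexp; congr (_ / _).
apply/funext => -[|[|n]]; rewrite fps_coefCM /fps_dilate ?expr0 ?mul1r//=.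
  by rewrite padic_logX ?(Cp_abs_sub1_lt1 p_prime)// mulr_natl.
by rewrite !mulr0.
Qed.

Lemma qbernoulli_sum_symmetric_series y n a b c :
    (0 < a)%N -> (0 < b)%N -> (0 < c)%N ->
  qbernoulli_sum q y n a b c = n`!%:R * symmetric_series q y a b c n.
Proof.
move=> a_gt0 b_gt0 c_gt0; rewrite qbernoulli_sum_coef//.
rewrite /qbernoulli_translates_gf fps_dilate_qbernoulli_gf ?muln_gt0 ?a_gt0//.
rewrite !qexp_geometric_sum ?qX_neq1 ?muln_gt0 ?a_gt0 ?b_gt0//.
have ac_inv : fpsC (a * c)%:R^-1 * fpsC (a * c)%:R = 1 :> fps C.
  by rewrite -rmorphM mulVf ?rmorph1// Cp_char0// muln_gt0 a_gt0.
rewrite [(b * c * a)%N]mulnC mulnA /symmetric_series; congr (_ * (_ : fps C) n).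
by rewrite -[log_add_t q in RHS]mul1r -ac_inv; ring.
Qed.

Lemma qbernoulli_sum_swapl y n a b c : (0 < a)%N -> (0 < b)%N -> (0 < c)%N ->
  qbernoulli_sum q y n a b c = qbernoulli_sum q y n b a c.
Proof.
by move=> *; rewrite !qbernoulli_sum_symmetric_series// symmetric_series_swapl.
Qed.

Lemma qbernoulli_sum_swapr y n a b c : (0 < a)%N -> (0 < b)%N -> (0 < c)%N ->
  qbernoulli_sum q y n a b c = qbernoulli_sum q y n a c b.
Proof.
by move=> *; rewrite !qbernoulli_sum_symmetric_series// symmetric_series_swapr.
Qed.

End QBernoulliSymmetry.

Theorem theorem4p11 (R : realType) (p : nat) (p_prime : prime p)
    (C : padic_complex R p) (q : C) (q_neq1 : q <> 1)
    (q_near1 : Cp_abs (q - 1) < p%:R `^ (- (p%:R - 1)^-1))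
    (w1 w2 w3 : nat) (w1_gt0 : (0 < w1)%N) (w2_gt0 : (0 < w2)%N)
    (w3_gt0 : (0 < w3)%N) (n : nat) (y1 : Qp C) (y1_Zp : padic_int y1) :
  let y : C := Cp_of_Qp y1 in
  let E1 : C := w1%:R ^ (n%:Z - 1) *
    \sum_(k < n.+1) 'C(n, k)%:R
      * qpower_sum (n - k) (q ^+ (w1 * w2)) (w3 - 1)
      * w2%:R ^+ (n - k) * w3%:R ^ (k%:Z - 1)
      * \sum_(i < w1) q ^+ (w2 * w3 * i)
          * (qbernoulli_poly k (q ^+ (w1 * w3))).[w2%:R * y + w2%:R / w1%:R * i%:R] in
  let E2 : C := w1%:R ^ (n%:Z - 1) *
    \sum_(k < n.+1) 'C(n, k)%:R
      * qpower_sum (n - k) (q ^+ (w1 * w3)) (w2 - 1)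
      * w3%:R ^+ (n - k) * w2%:R ^ (k%:Z - 1)
      * \sum_(i < w1) q ^+ (w2 * w3 * i)
          * (qbernoulli_poly k (q ^+ (w1 * w2))).[w3%:R * y + w3%:R / w1%:R * i%:R] in
  let E3 : C := w2%:R ^ (n%:Z - 1) *
    \sum_(k < n.+1) 'C(n, k)%:R
      * qpower_sum (n - k) (q ^+ (w1 * w2)) (w3 - 1)
      * w1%:R ^+ (n - k) * w3%:R ^ (k%:Z - 1)
      * \sum_(i < w2) q ^+ (w1 * w3 * i)
          * (qbernoulli_poly k (q ^+ (w2 * w3))).[w1%:R * y + w1%:R / w2%:R * i%:R] in
  let E4 : C := w2%:R ^ (n%:Z - 1) *
    \sum_(k < n.+1) 'C(n, k)%:R
      * qpower_sum (n - k) (q ^+ (w2 * w3)) (w1 - 1)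
      * w3%:R ^+ (n - k) * w1%:R ^ (k%:Z - 1)
      * \sum_(i < w2) q ^+ (w1 * w3 * i)
          * (qbernoulli_poly k (q ^+ (w1 * w2))).[w3%:R * y + w3%:R / w2%:R * i%:R] in
  let E5 : C := w3%:R ^ (n%:Z - 1) *
    \sum_(k < n.+1) 'C(n, k)%:R
      * qpower_sum (n - k) (q ^+ (w1 * w3)) (w2 - 1)
      * w1%:R ^+ (n - k) * w2%:R ^ (k%:Z - 1)
      * \sum_(i < w3) q ^+ (w1 * w2 * i)
          * (qbernoulli_poly k (q ^+ (w2 * w3))).[w1%:R * y + w1%:R / w3%:R * i%:R] in
  let E6 : C := w3%:R ^ (n%:Z - 1) *
    \sum_(k < n.+1) 'C(n, k)%:R
      * qpower_sum (n - k) (q ^+ (w2 * w3)) (w1 - 1)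
      * w2%:R ^+ (n - k) * w1%:R ^ (k%:Z - 1)
      * \sum_(i < w3) q ^+ (w1 * w2 * i)
          * (qbernoulli_poly k (q ^+ (w1 * w3))).[w2%:R * y + w2%:R / w3%:R * i%:R] in
  [/\ E1 = E2, E2 = E3, E3 = E4, E4 = E5 & E5 = E6].
Proof.
move/eqP: q_neq1 => q_neq1 y /=; pose S := qbernoulli_sum q y n.
have swapl a b c : (0 < a)%N -> (0 < b)%N -> (0 < c)%N -> S a b c = S b a c.
  exact: qbernoulli_sum_swapl.
have swapr a b c : (0 < a)%N -> (0 < b)%N -> (0 < c)%N -> S a b c = S a c b.
  exact: qbernoulli_sum_swapr.
suff: [/\ S w1 w2 w3 = S w1 w3 w2, S w1 w3 w2 = S w2 w1 w3,
    S w2 w1 w3 = S w2 w3 w1, S w2 w3 w1 = S w3 w1 w2 & S w3 w1 w2 = S w3 w2 w1].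
  by rewrite /S /qbernoulli_sum ![(w3 * _)%N]mulnC ![(w2 * w1)%N]mulnC.
split; try exact: swapr.
- by rewrite swapr// swapl.
- by rewrite swapl// swapr.
Qed.
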